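(* For $\operatorname{Re} p>0$, $$\int_0^\infty \frac{\sin ax\,\sinh bx}{\cos 2ax+\cosh 2bx}\,x^{p-1}\,dx=\frac{\Gamma(p)}{(a^2+b^2)^{p/2}}\,\sin\!\left(p\tan^{-1}\frac ab\right)\sum_{k=0}^\infty\frac{(-1)^k}{(2k+1)^p}.$$
   Context: $\Gamma$ is the Gamma function and $\tan^{-1}$ denotes the arctangent function. *)

(* Defs.v *)
From Stdlib Require Export Reals.
From Coquelicot Require Export Coquelicot.

Open Scope R_scope.

Definition Cexp (z : C) : C :=
  (exp (Re z) * cos (Im z), exp (Re z) * sin (Im z)).

Definition Csin (z : C) : C :=
  ((Cexp (Ci * z) - Cexp (- (Ci * z))) / (2 * Ci))%C.

(* x^z for a positive real base and a complex exponent.  Since [ln] is 0 on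
   nonpositive reals, the value is meaningless unless 0 < x. *)
Definition Rcpow (x : R) (z : C) : C := Cexp (z * RtoC (ln x)).

(* Integral over (0, +oo), improper at both ends: the limit of the integrals
   over [e, M] as e -> 0+ and M -> +oo.  It also asserts convergence. *)
Definition is_RInt_0_infty (f : R -> C) (l : C) : Prop :=
  is_RInt_gen (V := C_R_NormedModule) f (at_right 0) (Rbar_locally p_infty) l.

(* The Gamma function on the half-plane 0 < Re z, by Euler's integral, which
   converges there; outside that half-plane the value is meaningless. *)
Definition CGamma (z : C) : C :=
  RInt_gen (V := C_R_CompleteNormedModule)
    (fun t : R => (RtoC (exp (- t)) * Rcpow t (z - 1))%C)
    (at_right 0) (Rbar_locally p_infty).

(* Main.v *)
Require Import Defs.
From Stdlib Require Import Reals Lra Lia Psatz.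
From Coquelicot Require Import Coquelicot.
Open Scope R_scope.

(** With w = b + i a and b > 0, the integrand without its power of x is
    - Im (1 / (2 cosh (w x))), and 1 / (2 cosh (w x)) expands as the geometric
    series of the terms (-1)^k e^{-(2k+1) w x}.  The remainder after n terms is
    O(e^{-2nbx}) uniformly on (0, oo), so its Mellin transform is
    O(n^{- Re p}) and tends to 0, although the series of transforms need not
    converge absolutely.  Each term is evaluated by the rotated Euler integral
    of x^{p-1} e^{-wx}, equal to Gamma(p) w^{-p}.  The case b < 0 follows since
    both sides are invariant under (a, b) -> (-a, -b). *)

(** * Moving the contour of Euler's integral *)

(** Cauchy's theorem enters in real form: the path e^{uz}, 0 <= u <= 1, runs from 1 to e^z, and the
    u-derivative of the truncated integral is a difference of boundary terms. Working with the
    logarithm z makes w^{-p} equal to e^{-pz}, so no branch has to be chosen; |Im z| = |atan (a/b)|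
    < pi/2 keeps the whole path in the right half-plane, where the boundary terms vanish in the
    limit. The remainder bound has to hold down to x = 0 and through the zeros of cos (a x); it
    comes from cos 2ax + cosh 2bx = 2 |cosh (w x)|^2, which dominates e^{bx} up to a constant. Since
    p is complex, the imaginary part cannot be taken after multiplying by x^{p-1}: each sine is
    split into two conjugate exponentials, and these produce sin (p atan (a/b)). *)

(* With p = s + i t and z = al + i th, the product of path_modulus u x and
   cos (path_phase u x) is the real part of
   e^{ic} x^{p-1} exp (p u z - e^{uz} x); c = -pi/2 gives the imaginary part.
   Its u-derivative is the x-derivative of path_flux u, so that the integral
   over [e, M] changes along the path only through the two endpoints. *)
Section Rotation.
Variables s t al th c : R.

Definition path_modulus (u x : R) : R :=
  exp ((s - 1) * ln x + u * (s * al - t * th) - x * exp (u * al) * cos (u * th)).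
Definition path_phase (u x : R) : R :=
  t * ln x + u * (t * al + s * th) - x * exp (u * al) * sin (u * th) + c.

Definition path_deriv (u x : R) : R :=
  path_modulus u x * ((s * al - t * th - x * exp (u * al) * (al * cos (u * th) - th * sin (u * th)))
               * cos (path_phase u x)
             - (t * al + s * th - x * exp (u * al) * (al * sin (u * th) + th * cos (u * th)))
               * sin (path_phase u x)).
Definition path_flux (u x : R) : R :=
  x * path_modulus u x * (al * cos (path_phase u x) - th * sin (path_phase u x)).

Lemma is_derive_path (u x : R) :
  is_derive (fun v => path_modulus v x * cos (path_phase v x)) u (path_deriv u x).
Proof.
unfold path_modulus, path_phase, path_deriv; auto_derive; [easy|].
fold (path_modulus u x); fold (path_phase u x). unfold path_modulus, path_phase. unfold Rminus. ring.
Qed.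

(** Write g for the complex kernel and y = e^{uz} x. Then x g = e^{ic} y^p e^{-y} depends on y
    alone, so d/du acts on it as z x d/dx; dividing by x gives dg/du = d(z x g)/dx, and [path_flux]
    is the real part of z x g. *)
Lemma is_derive_path_flux (u x : R) : 0 < x -> is_derive (path_flux u) x (path_deriv u x).
Proof.
intros Hx. unfold path_flux, path_modulus, path_phase, path_deriv; auto_derive; [easy|].
fold (path_modulus u x); fold (path_phase u x). unfold path_modulus, path_phase. unfold Rminus. field. lra.
Qed.

Lemma continuity_2d_path_deriv (u x : R) : 0 < x -> continuity_2d_pt path_deriv u x.
Proof.
intros Hx.
assert (Hln : continuity_2d_pt (fun _ v => ln v) u x).
{ apply (continuity_1d_2d_pt_comp ln (fun _ v => v)).
  - apply derivable_continuous_pt. exists (/ x). now apply derivable_pt_lim_ln.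
  - apply continuity_2d_pt_id2. }
assert (He : forall g, continuity_2d_pt g u x ->
   continuity_2d_pt (fun u v => exp (g u v)) u x).
{ intros g Hg. apply (continuity_1d_2d_pt_comp exp); auto.
  apply derivable_continuous_pt, derivable_pt_exp. }
assert (Hc : forall g, continuity_2d_pt g u x ->
   continuity_2d_pt (fun u v => cos (g u v)) u x).
{ intros g Hg. apply (continuity_1d_2d_pt_comp cos); auto.
  apply continuity_cos. }
assert (Hs : forall g, continuity_2d_pt g u x ->
   continuity_2d_pt (fun u v => sin (g u v)) u x).
{ intros g Hg. apply (continuity_1d_2d_pt_comp sin); auto.
  apply continuity_sin. }
unfold path_deriv, path_modulus, path_phase.
repeat first [ apply continuity_2d_pt_id1 | apply continuity_2d_pt_id2
  | apply continuity_2d_pt_const | apply Hln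
  | apply He | apply Hc | apply Hs
  | apply continuity_2d_pt_minus | apply continuity_2d_pt_plus | apply continuity_2d_pt_mult].
Qed.

Lemma ex_derive_kernel_on_path (u x : R) :
  0 < x -> ex_derive (fun v => path_modulus u v * cos (path_phase u v)) x.
Proof.
intros Hx. unfold path_modulus, path_phase. auto_derive. easy.
Qed.

Lemma ex_RInt_kernel_on_path (u e M : R) :
  0 < e -> e <= M -> ex_RInt (fun v => path_modulus u v * cos (path_phase u v)) e M.
Proof.
intros He HM. apply (ex_RInt_continuous (V := R_CompleteNormedModule)).
intros x. rewrite Rmin_left, Rmax_right by lra. intros Hx.
apply (ex_derive_continuous (V := R_NormedModule)). apply ex_derive_kernel_on_path. lra.
Qed.

(** Differentiation under the integral sign, then the mean value theorem in u. The point u depends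
    on e and M, so later flux bounds must be uniform in u; the theorem is for real functions, which
    is why the phase c separates real and imaginary parts. *)
Lemma rotation_mvt (e M : R) :
  0 < e -> e <= M ->
  exists u, 0 <= u <= 1 /\
    RInt (fun x => path_modulus 1 x * cos (path_phase 1 x)) e M
    - RInt (fun x => path_modulus 0 x * cos (path_phase 0 x)) e M = path_flux u M - path_flux u e.
Proof.
intros He HM.
set (H := fun u => RInt (fun x => path_modulus u x * cos (path_phase u x)) e M).
assert (HD : forall u, is_derive H u (path_flux u M - path_flux u e)).
{ intros u.
  replace (path_flux u M - path_flux u e) with
    (RInt (fun x => Derive (fun v => path_modulus v x * cos (path_phase v x)) u) e M).
  - apply (is_derive_RInt_param (fun u x => path_modulus u x * cos (path_phase u x))).
    + apply filter_forall. intros v x _. eexists; apply is_derive_path.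
    + rewrite Rmin_left, Rmax_right by lra. intros x Hx.
      apply continuity_2d_pt_ext with path_deriv.
      * intros v y. symmetry. apply is_derive_unique, is_derive_path.
      * apply continuity_2d_path_deriv; lra.
    + apply filter_forall. intros v. apply ex_RInt_kernel_on_path; auto.
  - rewrite (RInt_ext _ (path_deriv u)).
    + apply is_RInt_unique. apply (is_RInt_derive (V := R_CompleteNormedModule) (path_flux u)).
      * rewrite Rmin_left, Rmax_right by lra. intros x Hx.
        apply is_derive_path_flux; lra.
      * rewrite Rmin_left, Rmax_right by lra. intros x Hx.
        apply (ex_derive_continuous (V := R_NormedModule)).
        unfold path_deriv, path_modulus, path_phase. auto_derive. repeat split; lra.
    + intros x _. apply is_derive_unique, is_derive_path. }
destruct (MVT_gen H 0 1 (fun u => path_flux u M - path_flux u e)) as [u [Hu Heq]].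
- intros; apply HD.
- intros x _. apply derivable_continuous_pt. exists (path_flux x M - path_flux x e).
  apply is_derive_Reals, HD.
- rewrite Rmin_left, Rmax_right in Hu by lra.
  exists u; split; auto. unfold H in Heq. rewrite Heq. ring.
Qed.

Lemma path_flux_bound (u x : R) : 0 < x ->
  Rabs (path_flux u x) <= x * path_modulus u x * (Rabs al + Rabs th).
Proof.
intros Hx. unfold path_flux.
assert (0 < path_modulus u x) by apply exp_pos.
rewrite 2!Rabs_mult, (Rabs_right x), (Rabs_right (path_modulus u x)) by lra.
apply Rmult_le_compat_l; [nra|].
unfold Rminus. eapply Rle_trans; [apply Rabs_triang|].
rewrite Rabs_Ropp, 2!Rabs_mult.
assert (Rabs (cos (path_phase u x)) <= 1) by (apply Rabs_le, COS_bound).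
assert (Rabs (sin (path_phase u x)) <= 1) by (apply Rabs_le, SIN_bound).
pose proof (Rabs_pos al). pose proof (Rabs_pos th). nra.
Qed.
End Rotation.

Lemma exp_le (x y : R) : x <= y -> exp x <= exp y.
Proof. intros [H| ->]; [left; now apply exp_increasing|right; auto]. Qed.

(** From ln y <= y at y = x / (s / c); the constant G is (s / c)^s. *)
Lemma Rpower_le_exp (s c : R) : 0 < s -> 0 < c ->
  exists G, 0 < G /\ forall x, 0 < x -> exp (s * ln x) <= G * exp (c * x).
Proof.
intros Hs Hc. exists (exp (s * ln (s / c))); split; [apply exp_pos|].
intros x Hx. rewrite <- exp_plus. apply exp_le.
assert (H0 : 0 < s / c) by (apply Rdiv_lt_0_compat; lra).
assert (H1 : 0 < x / (s / c)) by (apply Rdiv_lt_0_compat; lra).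
assert (H : ln (x / (s / c)) <= x / (s / c)).
{ apply Rle_trans with (ln (exp (x / (s / c)))).
  - apply ln_le; auto. pose proof (exp_ineq1 (x / (s / c))). lra.
  - rewrite ln_exp. lra. }
rewrite ln_div in H by auto.
replace (c * x) with (s * (x / (s / c))) by (field; lra).
nra.
Qed.

(** * Integrals over the half-line *)

Definition ends : (R * R -> Prop) -> Prop :=
  filter_prod (at_right 0) (Rbar_locally p_infty).

#[global] Instance ends_filter : ProperFilter ends.
Proof. unfold ends. apply filter_prod_proper. Qed.

Lemma ends_left (P : R -> Prop) : at_right 0 P -> ends (fun q => P (fst q)).
Proof.
intros H. unfold ends. apply Filter_prod with P (fun _ => True); auto.
apply filter_true.
Qed.

Lemma ends_right (P : R -> Prop) : Rbar_locally p_infty P -> ends (fun q => P (snd q)).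
Proof.
intros H. unfold ends. apply Filter_prod with (fun _ => True) P; auto.
apply filter_true.
Qed.

Lemma at_right_0_lt (d : R) : 0 < d -> at_right 0 (fun e => 0 < e < d).
Proof.
intros Hd. exists (mkposreal d Hd). intros y Hy Hy0. split; auto.
unfold ball in Hy; simpl in Hy; unfold AbsRing_ball, abs, minus, plus, opp in Hy; simpl in Hy.
rewrite Rabs_right in Hy; lra.
Qed.

Lemma ends_ordered : ends (fun q => 0 < fst q <= snd q).
Proof.
apply filter_imp with (fun q : R * R => 0 < fst q < 1 /\ 1 < snd q).
- intros q Hq; lra.
- apply filter_and.
  + apply (ends_left (fun e => 0 < e < 1)), at_right_0_lt; lra.
  + apply (ends_right (fun M => 1 < M)). exists 1; auto.
Qed.

Lemma at_right_0_power_lt (s k eta : R) : 0 < s -> 0 < eta ->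
  at_right 0 (fun e => exp (s * (ln e + k)) < eta).
Proof.
intros Hs He.
apply filter_imp with (fun e => 0 < e < exp (ln eta / s - k)).
- intros e [H0 H]. rewrite <- (exp_ln eta) by auto. apply exp_increasing.
  assert (H1 : ln e < ln eta / s - k).
  { rewrite <- (ln_exp (ln eta / s - k)). now apply ln_increasing. }
  replace (ln eta) with (s * (ln eta / s)) by (field; lra).
  apply Rmult_lt_compat_l; lra.
- apply at_right_0_lt, exp_pos.
Qed.

Lemma p_infty_exp_lt (m eta : R) : 0 < m -> 0 < eta ->
  Rbar_locally p_infty (fun M => exp (- m * M) < eta).
Proof.
intros Hm He. exists (- ln eta / m). intros M HM.
rewrite <- (exp_ln eta) at 1 by auto. apply exp_increasing.
assert (m * (- ln eta / m) < m * M) by (apply Rmult_lt_compat_l; auto).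
replace (m * (- ln eta / m)) with (- ln eta) in H by (field; lra). lra.
Qed.

Lemma p_infty_power_gt (s k A : R) : 0 < s -> 0 < A ->
  Rbar_locally p_infty (fun M => A < exp (s * (ln M + k))).
Proof.
intros Hs HA. exists (exp (ln A / s - k)). intros M HM.
assert (H1 : ln A / s - k < ln M).
{ rewrite <- (ln_exp (ln A / s - k)). apply ln_increasing; auto. apply exp_pos. }
rewrite <- (exp_ln A) by auto. apply exp_increasing.
replace (ln A) with (s * (ln A / s)) by (field; lra).
apply Rmult_lt_compat_l; lra.
Qed.

Lemma norm_C_R (z : C) : norm (V := C_R_NormedModule) z = Cmod z.
Proof.
unfold norm; simpl; unfold prod_norm, Cmod, norm; simpl.
f_equal. unfold abs; simpl. rewrite !Rmult_1_r.
change (Rabs (fst z) * Rabs (fst z)) with (Rsqr (Rabs (fst z))).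
change (Rabs (snd z) * Rabs (snd z)) with (Rsqr (Rabs (snd z))).
rewrite <- !Rsqr_abs. reflexivity.
Qed.

Lemma is_RInt_0_infty_iff (f : R -> C) (l : C) :
  is_RInt_0_infty f l <->
  forall eps, 0 < eps ->
    ends (fun q => exists I, is_RInt (V := C_R_NormedModule) f (fst q) (snd q) I
                             /\ Cmod (I - l) < eps).
Proof.
unfold is_RInt_0_infty, is_RInt_gen. rewrite filterlimi_locally.
fold ends. split; intros H eps.
- intros He.
  assert (Hn : 0 < norm_factor (V := C_R_NormedModule)) by apply norm_factor_gt_0.
  assert (He' : 0 < eps / norm_factor (V := C_R_NormedModule))
    by (apply Rdiv_lt_0_compat; auto).
  generalize (H (mkposreal _ He')); apply filter_imp.
  intros q [I [HI Hb]]. exists I; split; auto.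
  apply norm_compat2 in Hb. rewrite norm_C_R in Hb. simpl in Hb.
  replace eps with (norm_factor (V := C_R_NormedModule)
     * (eps / norm_factor (V := C_R_NormedModule))) by (field; lra).
  exact Hb.
- generalize (H eps (cond_pos eps)); apply filter_imp.
  intros q [I [HI Hb]]. exists I; split; auto.
  apply (norm_compat1 (V := C_R_NormedModule)). rewrite norm_C_R. exact Hb.
Qed.

Lemma is_RInt_0_infty_ext (f g : R -> C) (l : C) :
  (forall x, 0 < x -> f x = g x) -> is_RInt_0_infty f l -> is_RInt_0_infty g l.
Proof.
intros Hfg. apply is_RInt_gen_ext; [apply _ ..|].
fold ends. generalize ends_ordered; apply filter_imp.
intros q Hq x. rewrite Rmin_left, Rmax_right by lra.
intros Hx; apply Hfg; lra.
Qed.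

(** C is taken as a module over R, so [is_RInt_scal] covers only real factors; a complex factor is
    handled by components. *)
Lemma is_RInt_Cmult (k : C) (f : R -> C) (a b : R) (l : C) :
  is_RInt (V := C_R_NormedModule) f a b l ->
  is_RInt (V := C_R_NormedModule) (fun x => (k * f x)%C) a b (k * l)%C.
Proof.
intros H.
pose proof (is_RInt_fct_extend_fst (U := R_NormedModule) (V := R_NormedModule) f a b l H) as H1.
pose proof (is_RInt_fct_extend_snd (U := R_NormedModule) (V := R_NormedModule) f a b l H) as H2.
apply (is_RInt_fct_extend_pair (U := R_NormedModule) (V := R_NormedModule)).
- apply (is_RInt_minus (V := R_NormedModule)
    (fun x => fst k * fst (f x)) (fun x => snd k * snd (f x)));
  now apply (is_RInt_scal (V := R_NormedModule)).
- apply (is_RInt_plus (V := R_NormedModule)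
    (fun x => fst k * snd (f x)) (fun x => snd k * fst (f x)));
  now apply (is_RInt_scal (V := R_NormedModule)).
Qed.

Lemma is_RInt_0_infty_Cmult (k : C) (f : R -> C) (l : C) :
  is_RInt_0_infty f l -> is_RInt_0_infty (fun x => (k * f x)%C) (k * l)%C.
Proof.
rewrite 2!is_RInt_0_infty_iff. intros H eps He.
assert (Hk : 0 < Cmod k + 1) by (pose proof (Cmod_ge_0 k); lra).
generalize (H (eps / (Cmod k + 1)) (Rdiv_lt_0_compat _ _ He Hk)); apply filter_imp.
intros q [I [HI Hb]]. exists (k * I)%C; split; [now apply is_RInt_Cmult|].
replace (k * I - k * l)%C with (k * (I - l))%C by ring.
rewrite Cmod_mult.
apply Rle_lt_trans with ((Cmod k) * (eps / (Cmod k + 1))).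
- apply Rmult_le_compat_l; [apply Cmod_ge_0|lra].
- apply Rmult_lt_reg_r with (Cmod k + 1); auto.
  field_simplify; lra.
Qed.

Lemma is_RInt_0_infty_plus (f g : R -> C) (lf lg : C) :
  is_RInt_0_infty f lf -> is_RInt_0_infty g lg ->
  is_RInt_0_infty (fun x => (f x + g x)%C) (lf + lg)%C.
Proof. intros Hf Hg. exact (is_RInt_gen_plus (V := C_R_NormedModule) f g lf lg Hf Hg). Qed.

Lemma is_RInt_0_infty_minus (f g : R -> C) (lf lg : C) :
  is_RInt_0_infty f lf -> is_RInt_0_infty g lg ->
  is_RInt_0_infty (fun x => (f x - g x)%C) (lf - lg)%C.
Proof. intros Hf Hg. exact (is_RInt_gen_minus (V := C_R_NormedModule) f g lf lg Hf Hg). Qed.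

(* A primitive of a function comparable to x^{s-1} near 0 and integrable at
   infinity: 1 - 1/(1+y^s) with y = e^k x.  Being bounded by 1, it turns pointwise
   bounds into bounds of integrals, and k carries the scaling x -> e^k x. *)
Definition logistic (s k x : R) : R := 1 - / (1 + exp (s * (ln x + k))).
Definition logistic_deriv (s k x : R) : R :=
  s / x * exp (s * (ln x + k)) / (1 + exp (s * (ln x + k))) ^ 2.

Lemma is_derive_logistic (s k x : R) : 0 < x -> is_derive (logistic s k) x (logistic_deriv s k x).
Proof.
intros Hx. pose proof (exp_pos (s * (ln x + k))).
unfold logistic, logistic_deriv. auto_derive; [split; [auto|split; lra]|]. field. lra.
Qed.

Lemma logistic_bounds (s k x : R) : 0 <= logistic s k x <= 1.
Proof.
unfold logistic. pose proof (exp_pos (s * (ln x + k))).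
assert (0 < / (1 + exp (s * (ln x + k))) <= 1); [|lra].
split; [apply Rinv_0_lt_compat; lra|].
rewrite <- Rinv_1 at 2. apply Rinv_le_contravar; lra.
Qed.

Lemma is_RInt_logistic_deriv (s k e M : R) : 0 < e -> e <= M ->
  is_RInt (logistic_deriv s k) e M (logistic s k M - logistic s k e).
Proof.
intros He HM. apply (is_RInt_derive (V := R_CompleteNormedModule) (logistic s k)).
- rewrite Rmin_left, Rmax_right by lra. intros x Hx. apply is_derive_logistic; lra.
- rewrite Rmin_left, Rmax_right by lra. intros x Hx.
  apply (ex_derive_continuous (V := R_NormedModule)).
  pose proof (exp_pos (s * (ln x + k))).
  unfold logistic_deriv. auto_derive. repeat split; try lra.
  rewrite Rmult_1_r. apply Rmult_integral_contrapositive_currified; lra.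
Qed.

(** With y = e^k x, x^{s-1} = e^{-sk} y^s / x, so one constant serves every k. The factor e^{-sk} is
    the gain that becomes n^{-Re p} at k = ln n. *)
Lemma power_exp_le_logistic_deriv (s c : R) : 0 < s -> 0 < c ->
  exists A, 0 < A /\ forall k x, 0 < x ->
    exp ((s - 1) * ln x - c * exp k * x) <= A * exp (- s * k) * logistic_deriv s k x.
Proof.
intros Hs Hc.
(* The exponent is c / 2 because the denominator (1 + y^s)^2 squares the bound 1 + y^s <= (1 + G)
   e^{cy/2}, and e^{-cy} cancels the squared exponential exactly. *)
destruct (Rpower_le_exp s (c / 2) Hs ltac:(lra)) as [G [HG HE]].
exists ((1 + G) ^ 2 / s). split; [apply Rdiv_lt_0_compat; nra|].
intros k x Hx. unfold logistic_deriv.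
set (y := exp k * x). assert (Hy : 0 < y) by (apply Rmult_lt_0_compat; auto; apply exp_pos).
assert (Hl : ln y = ln x + k).
{ unfold y. rewrite ln_mult, ln_exp; auto; [ring|apply exp_pos]. }
specialize (HE y Hy). rewrite Hl in HE.
set (E := exp (s * (ln x + k))) in *.
assert (HE0 : 0 < E) by apply exp_pos.
replace (c * exp k * x) with (c * y) by (unfold y; ring).
replace (exp ((s - 1) * ln x - c * y)) with (exp (- s * k) * (E / x) * exp (- (c * y))).
2:{ unfold E. rewrite <- (exp_ln x) at 2 by auto. unfold Rdiv. rewrite <- exp_Ropp, <- !exp_plus.
    f_equal. ring. }
replace ((1 + G) ^ 2 / s * exp (- s * k) * (s / x * E / (1 + E) ^ 2))
  with (exp (- s * k) * (E / x) * ((1 + G) ^ 2 / (1 + E) ^ 2)) by (field; lra).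
apply Rmult_le_compat_l.
{ apply Rmult_le_pos; [left; apply exp_pos|]. left; apply Rdiv_lt_0_compat; auto. }
set (h := exp (c / 2 * y)) in *.
assert (Hh : 1 <= h).
{ unfold h. rewrite <- exp_0. apply exp_le. nra. }
replace (exp (- (c * y))) with (/ h ^ 2).
2:{ unfold h. rewrite exp_Ropp. f_equal. simpl. rewrite Rmult_1_r, <- exp_plus. f_equal. field. }
assert (H1 : 1 + E <= (1 + G) * h) by nra.
apply (Rmult_le_reg_r ((1 + E) ^ 2)); [nra|].
replace ((1 + G) ^ 2 / (1 + E) ^ 2 * (1 + E) ^ 2) with ((1 + G) ^ 2) by (field; lra).
apply (Rmult_le_reg_l (h ^ 2)); [nra|].
replace (h ^ 2 * (/ h ^ 2 * (1 + E) ^ 2)) with ((1 + E) ^ 2) by (field; lra).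
replace (h ^ 2 * (1 + G) ^ 2) with (((1 + G) * h) ^ 2) by ring.
apply pow_incr. lra.
Qed.

Lemma is_RInt_le_logistic (s k B : R) (f : R -> C) (e M : R) (I : C) :
  (forall x, 0 < x -> Cmod (f x) <= B * logistic_deriv s k x) ->
  0 < e -> e <= M -> is_RInt (V := C_R_NormedModule) f e M I ->
  Cmod I <= B * (logistic s k M - logistic s k e).
Proof.
intros Hf He HM HI. rewrite <- norm_C_R.
apply (norm_RInt_le (V := C_R_NormedModule) f (fun x => B * logistic_deriv s k x) e M); auto.
- intros x Hx. rewrite norm_C_R. apply Hf; lra.
- apply (is_RInt_scal (V := R_NormedModule)). now apply is_RInt_logistic_deriv.
Qed.

(** Cauchy's criterion: two truncations differ by at most B times the increments of [logistic] near
    the two ends, and these tend to 0. The total increment is at most 1, so B itself bounds the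
    limit. *)
Lemma ex_RInt_0_infty_of_bound (s k B : R) (f : R -> C) : 0 < s -> 0 <= B ->
  (forall e M, 0 < e -> e <= M -> ex_RInt (V := C_R_NormedModule) f e M) ->
  (forall x, 0 < x -> Cmod (f x) <= B * logistic_deriv s k x) ->
  exists l, is_RInt_0_infty f l /\ Cmod l <= B.
Proof.
intros Hs HB Hex Hf.
assert (Hb : forall x y, 0 < x -> 0 < y ->
   exists I, is_RInt (V := C_R_NormedModule) f x y I /\
     Cmod I <= B * Rabs (logistic s k y - logistic s k x)).
{ intros x y Hx Hy. destruct (Rle_dec x y) as [H|H].
  - destruct (Hex x y Hx H) as [I HI]. exists I; split; auto.
    eapply Rle_trans; [exact (is_RInt_le_logistic s k B f x y I Hf Hx H HI)|].
    apply Rmult_le_compat_l; auto. apply Rle_abs.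
  - destruct (Hex y x Hy ltac:(lra)) as [I HI]. exists (opp (I : C_R_NormedModule)); split.
    + now apply is_RInt_swap.
    + change (Cmod (- I) <= B * Rabs (logistic s k y - logistic s k x)).
      rewrite Cmod_opp, Rabs_minus_sym.
      eapply Rle_trans; [refine (is_RInt_le_logistic s k B f y x I Hf Hy _ HI); lra|].
      apply Rmult_le_compat_l; auto. apply Rle_abs. }
assert (HC : exists l : C_R_CompleteNormedModule,
   filterlim (fun q => RInt (V := C_R_CompleteNormedModule) f (fst q) (snd q)) ends (locally l)).
{ apply (filterlim_locally_cauchy (U := C_R_CompleteNormedModule)).
  intros eps.
  (* The two end pieces contribute at most 2 B eta < eps; B + 1 covers B = 0. *)
  set (eta := eps / (4 * (B + 1))).
  assert (Heta : 0 < eta).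
  { apply Rdiv_lt_0_compat; [apply cond_pos|lra]. }
  exists (fun q : R * R => 0 < fst q <= snd q /\ logistic s k (fst q) < eta /\
              1 - eta < logistic s k (snd q)).
  split.
  - apply filter_and; [apply ends_ordered|]. apply filter_and.
    + apply (ends_left (fun x => logistic s k x < eta)).
      generalize (at_right_0_power_lt s k eta Hs Heta). apply filter_imp.
      intros x Hx. unfold logistic.
      pose proof (exp_pos (s * (ln x + k))). set (E := exp _) in *.
      replace (1 - / (1 + E)) with (E / (1 + E)) by (field; lra).
      apply (Rmult_lt_reg_r (1 + E)); [lra|].
      replace (E / (1 + E) * (1 + E)) with E by (field; lra). nra.
    + apply (ends_right (fun x => 1 - eta < logistic s k x)).
      generalize (p_infty_power_gt s k (/ eta) Hs (Rinv_0_lt_compat _ Heta)). apply filter_imp.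
      intros x Hx. unfold logistic. set (E := exp _) in *.
      assert (/ (1 + E) < eta); [|lra].
      rewrite <- (Rinv_inv eta). apply Rinv_lt_contravar; [|lra].
      assert (0 < / eta) by now apply Rinv_0_lt_compat. nra.
  - intros [e M] [e' M'] [H1 [H2 H3]] [H1' [H2' H3']]. simpl in *.
    destruct (Hb e e' ltac:(lra) ltac:(lra)) as [I1 [HI1 HB1]].
    destruct (Hb M M' ltac:(lra) ltac:(lra)) as [I2 [HI2 HB2]].
    destruct (Hex e M ltac:(lra) ltac:(lra)) as [J HJ].
    assert (HJ' : is_RInt (V := C_R_NormedModule) f e' M' (- I1 + (J + I2))%C).
    { exact (is_RInt_Chasles (V := C_R_NormedModule) f e' e M' _ _
        (is_RInt_swap (V := C_R_NormedModule) f e' e I1 HI1)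
        (is_RInt_Chasles (V := C_R_NormedModule) f e M M' J I2 HJ HI2)). }
    rewrite (is_RInt_unique (V := C_R_CompleteNormedModule) _ _ _ _ HJ).
    rewrite (is_RInt_unique (V := C_R_CompleteNormedModule) _ _ _ _ HJ').
    apply (norm_compat1 (V := C_R_NormedModule)). rewrite norm_C_R.
    change (Cmod ((- I1 + (J + I2)) - J) < eps).
    replace ((- I1 + (J + I2)) - J)%C with (- I1 + I2)%C by ring.
    eapply Rle_lt_trans; [apply Cmod_triangle|]. rewrite Cmod_opp.
    pose proof (logistic_bounds s k e). pose proof (logistic_bounds s k e').
    pose proof (logistic_bounds s k M). pose proof (logistic_bounds s k M').
    assert (Rabs (logistic s k e' - logistic s k e) <= eta) by (apply Rabs_le; lra).
    assert (Rabs (logistic s k M' - logistic s k M) <= eta) by (apply Rabs_le; lra).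
    assert (Heps : pos eps = 4 * (B + 1) * eta) by (unfold eta; field; lra).
    rewrite Heps. nra. }
destruct HC as [l Hl].
assert (Hf0 : is_RInt_0_infty f l).
{ rewrite is_RInt_0_infty_iff. intros eps He.
  assert (Hn : 0 < norm_factor (V := C_R_NormedModule)) by apply norm_factor_gt_0.
  assert (He' : 0 < eps / norm_factor (V := C_R_NormedModule))
    by (apply Rdiv_lt_0_compat; auto).
  generalize (filter_and _ _ ends_ordered
    (proj1 (filterlim_locally (U := C_R_CompleteNormedModule) _ l) Hl (mkposreal _ He'))).
  apply filter_imp. intros [e M] [H1 H2]. simpl in *.
  destruct (Hex e M ltac:(lra) ltac:(lra)) as [J HJ].
  rewrite (is_RInt_unique (V := C_R_CompleteNormedModule) _ _ _ _ HJ) in H2.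
  exists J; split; auto.
  apply (norm_compat2 (V := C_R_NormedModule) l J (mkposreal _ He')) in H2.
  rewrite norm_C_R in H2. simpl in H2.
  replace eps with (norm_factor (V := C_R_NormedModule)
     * (eps / norm_factor (V := C_R_NormedModule))) by (field; lra).
  exact H2. }
exists l; split; auto.
apply Rnot_lt_le. intros Hlt.
rewrite is_RInt_0_infty_iff in Hf0.
destruct (filter_ex _ (filter_and _ _ ends_ordered (Hf0 (Cmod l - B) ltac:(lra))))
  as [[e M] [H1 [J [HJ HJl]]]]. simpl in *.
assert (Cmod J <= B).
{ eapply Rle_trans; [refine (is_RInt_le_logistic s k B f e M J Hf _ _ HJ); lra|].
  pose proof (logistic_bounds s k e). pose proof (logistic_bounds s k M). nra. }
pose proof (Cmod_triangle J (l - J)).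
replace (J + (l - J))%C with l in H0 by ring.
replace (l - J)%C with (- (J - l))%C in H0 by ring. rewrite Cmod_opp in H0. lra.
Qed.

(** * Vanishing of the boundary terms *)

Lemma cos_scaled_ge (u th : R) :
  0 <= u <= 1 -> Rabs th < PI / 2 -> cos th <= cos (u * th).
Proof.
intros Hu Hth.
assert (Habs : forall y, cos (Rabs y) = cos y).
{ intros y. unfold Rabs. destruct (Rcase_abs y); [apply cos_neg|auto]. }
rewrite <- (Habs th), <- (Habs (u * th)), Rabs_mult, (Rabs_right u) by lra.
pose proof (Rabs_pos th). pose proof PI_RGT_0.
apply cos_decr_1; nra.
Qed.

(** The flux is O(x^s e^{-mx}) uniformly in u, hence vanishes at both ends: at 0 through x^s, since
    s > 0, and at infinity through the exponential. *)
Lemma rotation_limit (s t al th c eps : R) : 0 < s -> Rabs th < PI / 2 -> 0 < eps ->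
  ends (fun q => Rabs (
     RInt (fun x => path_modulus s t al th 1 x * cos (path_phase s t al th c 1 x)) (fst q) (snd q)
     - RInt (fun x => path_modulus s t al th 0 x * cos (path_phase s t al th c 0 x)) (fst q) (snd q)) < eps).
Proof.
intros Hs Hth He.
(* A lower bound of Re e^{uz} = e^{u al} cos (u th) over 0 <= u <= 1. *)
set (m := exp (- Rabs al) * cos th).
assert (Hcth : 0 < cos th).
{ apply cos_gt_0; apply Rabs_def2 in Hth; lra. }
assert (Hm : 0 < m) by (apply Rmult_lt_0_compat; auto; apply exp_pos).
(* e^{|Re (p z)|} bounds |e^{puz}|, and |al| + |th| bounds |z|. *)
set (T := exp (Rabs (s * al - t * th)) * (Rabs al + Rabs th)).
assert (HT : 0 <= T).
{ apply Rmult_le_pos; [left; apply exp_pos|].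
  pose proof (Rabs_pos al). pose proof (Rabs_pos th). lra. }
assert (Hprim : forall u x, 0 <= u <= 1 -> 0 < x ->
   Rabs (path_flux s t al th c u x) <= T * (exp (s * ln x) * exp (- m * x))).
{ intros u x Hu Hx. eapply Rle_trans; [now apply path_flux_bound|].
  unfold T, path_modulus.
  replace (exp (Rabs (s * al - t * th)) * (Rabs al + Rabs th) * (exp (s * ln x) * exp (- m * x)))
    with (exp (Rabs (s * al - t * th) + s * ln x + - m * x) * (Rabs al + Rabs th))
    by (rewrite !exp_plus; ring).
  apply Rmult_le_compat_r.
  { pose proof (Rabs_pos al). pose proof (Rabs_pos th). lra. }
  rewrite <- (exp_ln x) at 1 by auto. rewrite <- exp_plus. apply exp_le.
  assert (u * (s * al - t * th) <= Rabs (s * al - t * th)).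
  { pose proof (Rle_abs (s * al - t * th)). pose proof (Rabs_pos (s * al - t * th)). nra. }
  assert (m * x <= x * exp (u * al) * cos (u * th)); [|lra].
  rewrite (Rmult_comm m), Rmult_assoc. apply Rmult_le_compat_l; [lra|].
  apply Rmult_le_compat; try lra.
  - left; apply exp_pos.
  - apply exp_le. pose proof (Rle_abs (- al)). rewrite Rabs_Ropp in H0.
    pose proof (Rabs_pos al). nra.
  - now apply cos_scaled_ge. }
(* Half of the decay absorbs the power of x; the other half still tends to 0 at infinity. *)
destruct (Rpower_le_exp s (m / 2) Hs ltac:(lra)) as [G [HG HGb]].
set (eta := eps / (2 * (T + 1) * (1 + G))).
assert (Heta : 0 < eta).
{ apply Rdiv_lt_0_compat; auto. nra. }
assert (Heq : eps = 2 * (T + 1) * (1 + G) * eta) by (unfold eta; field; lra).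
generalize (filter_and _ _ ends_ordered (filter_and _ _
  (ends_left _ (at_right_0_power_lt s 0 eta Hs Heta))
  (ends_right _ (p_infty_exp_lt (m / 2) eta ltac:(lra) Heta)))).
apply filter_imp. intros [e M] [H1 [H2 H3]]. simpl in *.
destruct (rotation_mvt s t al th c e M ltac:(lra) ltac:(lra)) as [u [Hu ->]].
pose proof (Hprim u e Hu ltac:(lra)) as He1.
pose proof (Hprim u M Hu ltac:(lra)) as HM1.
specialize (HGb M ltac:(lra)).
rewrite Rplus_0_r in H2.
assert (exp (s * ln e) * exp (- m * e) <= eta).
{ assert (exp (- m * e) <= 1) by (rewrite <- exp_0; apply exp_le; nra).
  pose proof (exp_pos (- m * e)). pose proof (exp_pos (s * ln e)). nra. }
assert (exp (s * ln M) * exp (- m * M) <= G * eta).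
{ replace (- m * M) with (- (m / 2 * M) + - (m / 2) * M) by field.
  rewrite exp_plus.
  assert (exp (s * ln M) * exp (- (m / 2 * M)) <= G).
  { rewrite exp_Ropp. apply Rmult_le_reg_r with (exp (m / 2 * M)); [apply exp_pos|].
    rewrite Rmult_assoc, Rinv_l by (apply Rgt_not_eq, exp_pos). lra. }
  pose proof (exp_pos (s * ln M)). pose proof (exp_pos (- (m / 2 * M))).
  pose proof (exp_pos (- (m / 2) * M)). nra. }
unfold Rminus. eapply Rle_lt_trans; [apply Rabs_triang|]. rewrite Rabs_Ropp.
rewrite Heq. nra.
Qed.

(** * The complex exponential and the rotated Gamma integral *)

Lemma Cexp_plus (y z : C) : Cexp (y + z) = (Cexp y * Cexp z)%C.
Proof.
unfold Cexp, Re, Im; simpl. rewrite exp_plus, cos_plus, sin_plus.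
apply injective_projections; simpl; ring.
Qed.

Lemma Cexp_0 : Cexp 0 = 1%C.
Proof.
unfold Cexp; simpl. rewrite exp_0, cos_0, sin_0. apply injective_projections; simpl; ring.
Qed.

Lemma Cexp_neq_0 (z : C) : Cexp z <> 0%C.
Proof.
intros H. apply C1_nz. rewrite <- Cexp_0. replace (RtoC 0) with (z + - z)%C by ring.
rewrite Cexp_plus, H. ring.
Qed.

Lemma Cexp_opp (z : C) : Cexp (- z) = (/ Cexp z)%C.
Proof.
assert (Cexp z * Cexp (- z) = 1)%C.
{ rewrite <- Cexp_plus. replace (z + - z)%C with (RtoC 0) by ring. apply Cexp_0. }
pose proof (Cexp_neq_0 z).
rewrite <- (Cmult_1_l (Cexp (- z))), <- (Cinv_l (Cexp z)) by auto.
rewrite <- Cmult_assoc, H. ring.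
Qed.

Lemma Cmod_Cexp (z : C) : Cmod (Cexp z) = exp (Re z).
Proof.
unfold Cmod, Cexp; simpl.
replace (exp (Re z) * cos (Im z) * (exp (Re z) * cos (Im z) * 1) +
  exp (Re z) * sin (Im z) * (exp (Re z) * sin (Im z) * 1)) with (Rsqr (exp (Re z))).
- apply sqrt_Rsqr. left; apply exp_pos.
- pose proof (sin2_cos2 (Im z)). unfold Rsqr in *.
  transitivity (exp (Re z) * exp (Re z) * (sin (Im z) * sin (Im z) + cos (Im z) * cos (Im z))).
  + rewrite H; ring.
  + ring.
Qed.

Lemma Cexp_RtoC (r : R) : Cexp r = RtoC (exp r).
Proof.
unfold Cexp; simpl. rewrite cos_0, sin_0. apply injective_projections; simpl; ring.
Qed.

Lemma Cmod_le_Rabs (z : C) : Cmod z <= Rabs (Re z) + Rabs (Im z).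
Proof.
replace z with (RtoC (Re z) + Ci * RtoC (Im z))%C at 1.
- eapply Rle_trans; [apply Cmod_triangle|]. rewrite Cmod_mult, !Cmod_R.
  replace (Cmod Ci) with 1; [lra|]. unfold Cmod; simpl. symmetry.
  replace (0 * (0 * 1) + 1 * (1 * 1)) with 1 by ring. apply sqrt_1.
- apply injective_projections; unfold Re, Im; simpl; ring.
Qed.

(* x^{p-1} e^{-wx} *)
Definition mellin_kernel (p w : C) (x : R) : C := Cexp ((p - 1) * RtoC (ln x) - w * RtoC x).

Lemma Cmod_mellin_kernel (p w : C) (x : R) :
  Cmod (mellin_kernel p w x) = exp ((Re p - 1) * ln x - Re w * x).
Proof.
unfold mellin_kernel. rewrite Cmod_Cexp. f_equal. simpl. unfold Re. ring.
Qed.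

Lemma ex_RInt_C (f : R -> C) (e M : R) :
  ex_RInt (V := R_NormedModule) (fun x => fst (f x)) e M ->
  ex_RInt (V := R_NormedModule) (fun x => snd (f x)) e M ->
  ex_RInt (V := C_R_NormedModule) f e M.
Proof.
intros [I HI] [J HJ]. exists (I, J).
now apply (is_RInt_fct_extend_pair (U := R_NormedModule) (V := R_NormedModule)).
Qed.

Lemma ex_RInt_of_ex_derive (g : R -> R) (e M : R) : 0 < e -> e <= M ->
  (forall x, 0 < x -> ex_derive g x) -> ex_RInt g e M.
Proof.
intros He HM Hg. apply (ex_RInt_continuous (V := R_CompleteNormedModule)).
intros x. rewrite Rmin_left, Rmax_right by lra. intros Hx.
apply (ex_derive_continuous (V := R_NormedModule)), Hg. lra.
Qed.

Lemma ex_RInt_mult_mellin_kernel (g : R -> R) (p w : C) (e M : R) : 0 < e -> e <= M ->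
  (forall x, 0 < x -> ex_derive g x) ->
  ex_RInt (V := C_R_NormedModule) (fun x => (RtoC (g x) * mellin_kernel p w x)%C) e M.
Proof.
intros He HM Hg.
apply ex_RInt_C; apply ex_RInt_of_ex_derive; auto; intros x Hx; simpl; unfold Re, Im; simpl;
auto_derive; repeat split; auto.
Qed.

Lemma ex_RInt_mellin_kernel (p w : C) (e M : R) : 0 < e -> e <= M ->
  ex_RInt (V := C_R_NormedModule) (mellin_kernel p w) e M.
Proof.
intros He HM.
apply ex_RInt_C; apply ex_RInt_of_ex_derive; auto; intros x Hx; simpl; unfold Re, Im; simpl;
auto_derive; repeat split; auto.
Qed.

(** [CGamma] is a total [RInt_gen]; domination by [logistic_deriv] proves convergence, so that its
    value really is the integral. *)
Lemma is_RInt_mellin_kernel_1 (p : C) : 0 < Re p -> is_RInt_0_infty (mellin_kernel p 1) (CGamma p).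
Proof.
intros Hp.
destruct (power_exp_le_logistic_deriv (Re p) 1 Hp Rlt_0_1) as [A [HA HAb]].
destruct (ex_RInt_0_infty_of_bound (Re p) 0 A (mellin_kernel p 1)) as [l [Hl _]]; auto; try lra.
- intros; now apply ex_RInt_mellin_kernel.
- intros x Hx. rewrite Cmod_mellin_kernel. specialize (HAb 0 x Hx).
  rewrite Rmult_0_r, exp_0, !Rmult_1_r in HAb. simpl. exact HAb.
- replace (CGamma p) with l; auto. symmetry. unfold CGamma.
  apply (is_RInt_gen_unique (V := C_R_CompleteNormedModule)).
  revert Hl. apply is_RInt_0_infty_ext. intros x Hx. unfold mellin_kernel, Rcpow.
  rewrite <- Cexp_RtoC, <- Cexp_plus. f_equal.
  apply injective_projections; simpl; ring.
Qed.

(** At u = 0 the path carries the Gamma integrand, at u = 1 it carries e^{pz} times the kernel at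
    e^z; by [rotation_limit] both have the same integral. *)
Lemma is_RInt_mellin_kernel (p z : C) : 0 < Re p -> Rabs (Im z) < PI / 2 ->
  is_RInt_0_infty (mellin_kernel p (Cexp z)) (CGamma p * Cexp (- (p * z)))%C.
Proof.
intros Hp Hz.
assert (H : is_RInt_0_infty (fun x => Cexp (p * z) * mellin_kernel p (Cexp z) x)%C (CGamma p)).
{ rewrite is_RInt_0_infty_iff. intros eps He.
  pose proof (proj1 (is_RInt_0_infty_iff _ _) (is_RInt_mellin_kernel_1 p Hp) (eps / 2) ltac:(lra)) as H0.
  pose proof (rotation_limit (Re p) (Im p) (Re z) (Im z) 0 (eps / 4) Hp Hz ltac:(lra)) as H1.
  pose proof (rotation_limit (Re p) (Im p) (Re z) (Im z) (- (PI / 2)) (eps / 4) Hp Hz ltac:(lra)) as H2.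
  generalize (filter_and _ _ ends_ordered (filter_and _ _ H0 (filter_and _ _ H1 H2))).
  clear H0 H1 H2. apply filter_imp. intros [e M] [HeM [[I [HI HIG]] [H1 H2]]]. simpl in *.
  destruct (ex_RInt_mellin_kernel p (Cexp z) e M ltac:(lra) ltac:(lra)) as [J HJ].
  apply (is_RInt_Cmult (Cexp (p * z))) in HJ.
  exists (Cexp (p * z) * J)%C; split; auto.
  set (J' := (Cexp (p * z) * J)%C) in *.
  assert (Hsin : forall y, cos (y + - (PI / 2)) = sin y).
  { intros y. rewrite cos_plus, cos_neg, sin_neg, cos_PI2, sin_PI2. ring. }
  assert (HJ1 : RInt (fun x => path_modulus (Re p) (Im p) (Re z) (Im z) 1 x
                * cos (path_phase (Re p) (Im p) (Re z) (Im z) 0 1 x)) e M = Re J').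
  { apply is_RInt_unique.
    refine (is_RInt_ext (V := R_NormedModule) _ _ _ _ _ _
      (is_RInt_fct_extend_fst (U := R_NormedModule) (V := R_NormedModule) _ _ _ _ HJ)).
    intros x _. unfold mellin_kernel. rewrite <- Cexp_plus. unfold path_modulus, path_phase.
    unfold Cexp, Re, Im; simpl. f_equal; f_equal; rewrite ?Rmult_1_l; ring. }
  assert (HJ2 : RInt (fun x => path_modulus (Re p) (Im p) (Re z) (Im z) 1 x
                * cos (path_phase (Re p) (Im p) (Re z) (Im z) (- (PI / 2)) 1 x)) e M = Im J').
  { apply is_RInt_unique.
    refine (is_RInt_ext (V := R_NormedModule) _ _ _ _ _ _
      (is_RInt_fct_extend_snd (U := R_NormedModule) (V := R_NormedModule) _ _ _ _ HJ)).
    intros x _. unfold mellin_kernel. rewrite <- Cexp_plus. unfold path_modulus, path_phase. rewrite Hsin.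
    unfold Cexp, Re, Im; simpl. f_equal; f_equal; rewrite ?Rmult_1_l; ring. }
  assert (HI1 : RInt (fun x => path_modulus (Re p) (Im p) (Re z) (Im z) 0 x
                * cos (path_phase (Re p) (Im p) (Re z) (Im z) 0 0 x)) e M = Re I).
  { apply is_RInt_unique.
    refine (is_RInt_ext (V := R_NormedModule) _ _ _ _ _ _
      (is_RInt_fct_extend_fst (U := R_NormedModule) (V := R_NormedModule) _ _ _ _ HI)).
    intros x _. unfold mellin_kernel, path_modulus, path_phase. rewrite !Rmult_0_l, exp_0, cos_0, sin_0.
    unfold Cexp, Re, Im; simpl. f_equal; f_equal; ring. }
  assert (HI2 : RInt (fun x => path_modulus (Re p) (Im p) (Re z) (Im z) 0 x
                * cos (path_phase (Re p) (Im p) (Re z) (Im z) (- (PI / 2)) 0 x)) e M = Im I).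
  { apply is_RInt_unique.
    refine (is_RInt_ext (V := R_NormedModule) _ _ _ _ _ _
      (is_RInt_fct_extend_snd (U := R_NormedModule) (V := R_NormedModule) _ _ _ _ HI)).
    intros x _. unfold mellin_kernel, path_modulus, path_phase. rewrite Hsin, !Rmult_0_l, exp_0, cos_0, sin_0.
    unfold Cexp, Re, Im; simpl. f_equal; f_equal; ring. }
  rewrite HJ1, HI1 in H1. rewrite HJ2, HI2 in H2.
  replace (J' - CGamma p)%C with ((J' - I) + (I - CGamma p))%C by ring.
  eapply Rle_lt_trans; [apply Cmod_triangle|].
  pose proof (Cmod_le_Rabs (J' - I)) as H3.
  change (Cmod (J' - I) <= Rabs (Re J' - Re I) + Rabs (Im J' - Im I)) in H3.
  lra. }
apply (is_RInt_0_infty_Cmult (Cexp (- (p * z)))) in H.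
rewrite Cmult_comm. revert H. apply is_RInt_0_infty_ext. intros x Hx.
rewrite Cexp_opp. field. apply Cexp_neq_0.
Qed.

(** * The series *)

(** The derivative of v^{-s} cos (t ln v + c) is at most (s + |t|) v^{-s-1} in absolute value, which
    is (s + |t|) / s times minus the derivative of v^{-s}. The resulting bound telescopes along a
    sequence. *)
Lemma oscillating_power_increment (s t c x y : R) : 0 < s -> 0 < x -> x <= y ->
  Rabs (exp (- s * ln y) * cos (t * ln y + c) - exp (- s * ln x) * cos (t * ln x + c))
  <= (s + Rabs t) / s * (exp (- s * ln x) - exp (- s * ln y)).
Proof.
intros Hs Hx Hxy.
assert (H : forall e, e = 1 \/ e = -1 ->
  e * (exp (- s * ln y) * cos (t * ln y + c) - exp (- s * ln x) * cos (t * ln x + c))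
  <= (s + Rabs t) / s * (exp (- s * ln x) - exp (- s * ln y))).
{ intros e He.
  (* The inequality says h y <= h x; e = 1 and e = -1 give the two sides of the absolute value. *)
  set (h := fun v => (s + Rabs t) / s * exp (- s * ln v)
                     + e * (exp (- s * ln v) * cos (t * ln v + c))).
  set (dh := fun v => exp (- s * ln v) / v
     * (- (s + Rabs t) + e * (- s * cos (t * ln v + c) - t * sin (t * ln v + c)))).
  assert (Hd : forall v, 0 < v -> is_derive h v (dh v)).
  { intros v Hv. unfold h, dh. auto_derive; [auto|]. field. lra. }
  destruct (MVT_gen h x y dh) as [v [Hv Heq]].
  - rewrite Rmin_left, Rmax_right by lra. intros v Hv. apply Hd; lra.
  - rewrite Rmin_left, Rmax_right by lra. intros v Hv.
    apply derivable_continuous_pt. exists (dh v). apply is_derive_Reals, Hd. lra.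
  - rewrite Rmin_left, Rmax_right in Hv by lra.
    assert (dh v <= 0).
    { unfold dh. assert (0 < exp (- s * ln v) / v).
      { apply Rdiv_lt_0_compat; [apply exp_pos|lra]. }
      pose proof (COS_bound (t * ln v + c)). pose proof (SIN_bound (t * ln v + c)).
      assert (Hc : - (e * s * cos (t * ln v + c)) <= s) by (destruct He; subst e; nra).
      assert (Ht : - (e * t * sin (t * ln v + c)) <= Rabs t).
      { eapply Rle_trans; [apply Rle_abs|]. rewrite Rabs_Ropp, 2!Rabs_mult.
        assert (Rabs e = 1) by (destruct He; subst e; [apply Rabs_R1|rewrite Rabs_m1; auto]).
        assert (Rabs (sin (t * ln v + c)) <= 1) by (apply Rabs_le; auto).
        pose proof (Rabs_pos t). rewrite H2. nra. }
      nra. }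
    assert (h y - h x <= 0) by (rewrite Heq; nra).
    unfold h in H0. lra. }
apply Rabs_le. pose proof (H 1 (or_introl eq_refl)). pose proof (H (-1) (or_intror eq_refl)).
lra.
Qed.

Lemma is_lim_seq_power_neg (s : R) (n : nat -> nat) : 0 < s -> (forall k, (k <= n k)%nat) ->
  is_lim_seq (fun k => exp (- s * ln (INR (n k)))) 0.
Proof.
intros Hs Hn. apply is_lim_seq_spec. intros eps.
destruct (p_infty_power_gt s 0 (/ eps) Hs (Rinv_0_lt_compat _ (cond_pos eps))) as [X HX].
destruct (INR_unbounded X) as [N HN].
exists N. intros k Hk. specialize (HX (INR (n k))).
assert (X < INR (n k)).
{ apply Rlt_le_trans with (INR N); auto. apply le_INR. specialize (Hn k). lia. }
specialize (HX H). rewrite Rplus_0_r in HX.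
rewrite Rminus_0_r, Rabs_right by (left; apply exp_pos).
rewrite <- (Rinv_inv eps). replace (- s * ln (INR (n k))) with (- (s * ln (INR (n k)))) by ring.
rewrite exp_Ropp. apply Rinv_lt_contravar; auto.
apply Rmult_lt_0_compat; [apply Rinv_0_lt_compat, cond_pos|apply exp_pos].
Qed.

Lemma ex_series_telescope (v : nat -> R) : is_lim_seq v 0 -> ex_series (fun k => v k - v (S k)).
Proof.
intros Hv. exists (v O).
change (is_lim_seq (sum_n (fun k => v k - v (S k))) (v O)).
apply is_lim_seq_ext with (fun n => v O - v (S n)).
- intros n. induction n as [|n IH].
  + now rewrite sum_O.
  + rewrite sum_Sn, <- IH. unfold plus; simpl. ring.
- replace (v O) with (v O - 0) at 1 by ring.
  apply is_lim_seq_minus'; [apply is_lim_seq_const|]. now apply is_lim_seq_incr_1 in Hv.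
Qed.

(** Dirichlet's test. The cosine destroys the monotonicity that Leibniz's criterion asks for, but
    the coefficients still have bounded variation, by comparison with a telescoping series, and the
    partial sums of (-1)^k are 0 or 1. *)
Lemma ex_series_alternating_power (s t c : R) : 0 < s ->
  ex_series (fun k => exp (- s * ln (INR (2 * k + 1))) * cos (t * ln (INR (2 * k + 1)) + c)
                      * (-1) ^ k).
Proof.
intros Hs.
pose proof (is_lim_seq_power_neg s (fun k => (2 * k + 1)%nat) Hs ltac:(intros; cbv beta; lia)) as Hlim.
apply (partial_summation_R
  (fun k => exp (- s * ln (INR (2 * k + 1))) * cos (t * ln (INR (2 * k + 1)) + c))
  (fun k => (-1) ^ k)).
- exists 1. intros n.
  assert (H : sum_n (fun k => (-1) ^ k) n = 0 \/ sum_n (fun k => (-1) ^ k) n = 1).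
  { assert (H : 2 * sum_n (fun k => (-1) ^ k) n = 1 + (-1) ^ n).
    { induction n as [|n IH].
      - rewrite sum_O. simpl; ring.
      - rewrite sum_Sn. unfold plus; simpl. simpl in IH. lra. }
    assert ((-1) ^ n = 1 \/ (-1) ^ n = -1).
    { clear H. induction n as [|n [IH|IH]]; simpl; [left; auto|right|left]; rewrite IH; ring. }
    lra. }
  unfold norm; simpl; unfold abs; simpl.
  apply Rabs_le. lra.
- apply (is_lim_seq_le_le (fun k => - exp (- s * ln (INR (2 * k + 1)))) _
      (fun k => exp (- s * ln (INR (2 * k + 1)))) 0); auto.
  + intros k. pose proof (COS_bound (t * ln (INR (2 * k + 1)) + c)).
    pose proof (exp_pos (- s * ln (INR (2 * k + 1)))). nra.
  + apply is_lim_seq_opp in Hlim. simpl in Hlim. now rewrite Ropp_0 in Hlim.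
- apply (ex_series_le (V := R_CompleteNormedModule) _
    (fun k => scal ((s + Rabs t) / s)
       (exp (- s * ln (INR (2 * k + 1))) - exp (- s * ln (INR (2 * S k + 1)))))).
  + intros k.
    change (Rabs (Rabs (
      exp (- s * ln (INR (2 * S k + 1))) * cos (t * ln (INR (2 * S k + 1)) + c)
      - exp (- s * ln (INR (2 * k + 1))) * cos (t * ln (INR (2 * k + 1)) + c)))
      <= (s + Rabs t) / s
         * (exp (- s * ln (INR (2 * k + 1))) - exp (- s * ln (INR (2 * S k + 1))))).
    rewrite Rabs_Rabsolu.
    apply oscillating_power_increment; auto.
    * apply lt_0_INR; lia.
    * apply le_INR; lia.
  + apply (ex_series_scal_l (V := R_NormedModule)).
    now apply (ex_series_telescope (fun k => exp (- s * ln (INR (2 * k + 1))))).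
Qed.

Lemma is_series_C (f : nat -> C) (l1 l2 : R) :
  is_series (fun k => Re (f k)) l1 -> is_series (fun k => Im (f k)) l2 ->
  is_series (V := C_R_NormedModule) f (l1, l2).
Proof.
unfold is_series. intros H1 H2.
apply filterlim_ext with
  (fun n => (sum_n (fun k => Re (f k)) n, sum_n (fun k => Im (f k)) n) : C_R_NormedModule).
- intros n. induction n as [|n IH].
  + rewrite !sum_O. now destruct (f O).
  + rewrite !sum_Sn, <- IH. reflexivity.
- apply filterlim_locally. intros eps.
  generalize (filter_and _ _ (proj1 (filterlim_locally _ _) H1 eps)
                             (proj1 (filterlim_locally _ _) H2 eps)).
  apply filter_imp. intros n [Ha Hb]. split; auto.
Qed.

(** With p = s + i t, n^{-p} = n^{-s} (cos (t ln n) - i sin (t ln n)); the shift c = pi/2 supplies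
    the -sin. *)
Lemma beta_series_converges (p : C) : 0 < Re p ->
  exists S : C, is_series (V := C_R_NormedModule)
    (fun k : nat => (RtoC ((-1) ^ k) / Rcpow (INR (2 * k + 1)) p)%C) S.
Proof.
intros Hp.
destruct (ex_series_alternating_power (Re p) (Im p) 0 Hp) as [S1 H1].
destruct (ex_series_alternating_power (Re p) (Im p) (PI / 2) Hp) as [S2 H2].
exists (S1, S2).
assert (E : forall k, (RtoC ((-1) ^ k) / Rcpow (INR (2 * k + 1)) p)%C
   = (RtoC ((-1) ^ k) * Cexp (- (p * RtoC (ln (INR (2 * k + 1))))))%C).
{ intros k. rewrite Cexp_opp. reflexivity. }
apply is_series_C.
- revert H1. apply is_series_ext. intros k. rewrite E.
  rewrite Rplus_0_r, <- (cos_neg (Im p * _)).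
  unfold Cexp, Re, Im; simpl.
  rewrite Rmult_0_l, Rminus_0_r, Rmult_comm. f_equal; f_equal; f_equal; ring.
- revert H2. apply is_series_ext. intros k. rewrite E.
  rewrite cos_plus, cos_PI2, sin_PI2, Rmult_0_r, Rmult_1_r, Rminus_0_l, <- sin_neg.
  unfold Cexp, Re, Im; simpl.
  rewrite Rmult_0_l, Rplus_0_r, Rmult_comm. f_equal; f_equal; f_equal; ring.
Qed.

(** * The geometric expansion of the integrand *)

Definition denom (a b x : R) : R := cos (2 * a * x) + cosh (2 * b * x).

(* With w = b + i a, this is the imaginary part of
   - (-1)^n e^{-2nwx} / (2 cosh (w x)), the remainder after n terms of the
   geometric expansion of the integrand; n = 0 gives the integrand itself. *)
Definition sech_remainder (a b : R) (n : nat) (x : R) : R :=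
  (-1) ^ n * exp (- (2 * INR n * b * x))
  * (cos (2 * INR n * a * x) * sinh (b * x) * sin (a * x)
     + sin (2 * INR n * a * x) * cosh (b * x) * cos (a * x)) / denom a b x.

(** Both sides are 2 |cosh (w x)|^2 with w = b + i a; the sum of squares yields positivity and lower
    bounds. *)
Lemma denom_eq (a b x : R) : denom a b x = 2 * (sinh (b * x) ^ 2 + cos (a * x) ^ 2).
Proof.
unfold denom. replace (2 * a * x) with (2 * (a * x)) by ring.
rewrite cos_2a_cos. unfold cosh, sinh.
replace (2 * b * x) with (b * x + b * x) by ring.
rewrite Ropp_plus_distr, !exp_plus, exp_Ropp. field.
apply Rgt_not_eq, exp_pos.
Qed.

Lemma sinh_pos (x : R) : 0 < x -> 0 < sinh x.
Proof.
intros Hx. unfold sinh. assert (exp (- x) < exp x) by (apply exp_increasing; lra). lra.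
Qed.

Lemma denom_pos (a b x : R) : 0 < b -> 0 < x -> 0 < denom a b x.
Proof.
intros Hb Hx. rewrite denom_eq.
assert (0 < sinh (b * x)) by (apply sinh_pos; nra). nra.
Qed.

(** This is (1 + e^{-2wx}) / (2 cosh (w x)) = e^{-wx}, multiplied by (-1)^n e^{-2nwx}, in negated
    imaginary parts. *)
Lemma sech_remainder_step (a b : R) (n : nat) (x : R) : 0 < b -> 0 < x ->
  sech_remainder a b n x - sech_remainder a b (S n) x
  = (-1) ^ n * exp (- (INR (2 * n + 1) * b * x)) * sin (INR (2 * n + 1) * a * x).
Proof.
intros Hb Hx. pose proof (denom_pos a b x Hb Hx) as Hd.
unfold sech_remainder. rewrite S_INR, plus_INR, mult_INR. simpl (INR 2). simpl (INR 1).
simpl ((-1) ^ S n).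
apply (Rmult_eq_reg_r (denom a b x)); [|lra].
set (K := cos (2 * INR n * a * x)). set (L := sin (2 * INR n * a * x)).
unfold Rminus. rewrite Rmult_plus_distr_r, Ropp_mult_distr_l_reverse.
unfold Rdiv. rewrite !(Rmult_assoc _ (/ denom a b x)), Rinv_l by lra.
rewrite !Rmult_1_r, denom_eq.
replace (2 * (INR n + 1) * a * x) with (2 * INR n * a * x + 2 * (a * x)) by ring.
replace ((1 + 1) * INR n + 1) with (2 * INR n + 1) by ring.
replace ((2 * INR n + 1) * a * x) with (2 * INR n * a * x + a * x) by ring.
replace (- (2 * (INR n + 1) * b * x)) with (- (2 * INR n * b * x) + - (b * x) + - (b * x)) by ring.
replace (- ((2 * INR n + 1) * b * x)) with (- (2 * INR n * b * x) + - (b * x)) by ring.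
rewrite cos_plus, !sin_plus, cos_2a_cos, sin_2a, !exp_plus. fold K L.
unfold sinh, cosh. rewrite (exp_Ropp (b * x)).
set (E := exp (b * x)). assert (E <> 0) by apply Rgt_not_eq, exp_pos.
set (P := exp (- (2 * INR n * b * x))).
pose proof (sin2_cos2 (a * x)) as Hsc. unfold Rsqr in Hsc.
set (s := sin (a * x)) in *. set (k := cos (a * x)) in *.
assert (Hs : s * s = 1 - k * k) by lra.
field [Hs]; auto.
Qed.

(** Neither square in [denom_eq] suffices alone: sinh (b x) tends to 0 at 0, and cos (a x) may
    vanish further out. Up to x0 the cosine is used, beyond it the hyperbolic sine. *)
Lemma exp_le_denom (a b : R) : 0 < b ->
  exists B, 0 < B /\ forall x, 0 < x -> exp (b * x) <= B * denom a b x.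
Proof.
intros Hb. pose proof (Rabs_pos a) as Ha.
(* Keeps |a x| <= 1 on (0, x0], hence cos (a x) >= cos 1 > 0; the added 1 allows a = 0. *)
set (x0 := / (Rabs a + 1)). assert (Hx0 : 0 < x0) by (apply Rinv_0_lt_compat; lra).
(* sinh (b x) = e^{bx} (1 - e^{-2bx}) / 2 >= k e^{bx} for x >= x0. *)
set (k := (1 - exp (- (2 * b * x0))) / 2).
assert (Hk : 0 < k).
{ unfold k. assert (exp (- (2 * b * x0)) < 1); [|lra].
  rewrite <- exp_0. apply exp_increasing. nra. }
assert (Hc : 0 < cos 1).
{ pose proof PI2_1. apply cos_gt_0; lra. }
exists (exp (b * x0) / cos 1 ^ 2 + / k ^ 2). split.
{ apply Rplus_lt_0_compat; [apply Rdiv_lt_0_compat|apply Rinv_0_lt_compat]; try nra.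
  apply exp_pos. }
intros x Hx. rewrite denom_eq.
assert (H1 : 0 < exp (b * x0) / cos 1 ^ 2) by (apply Rdiv_lt_0_compat; [apply exp_pos|nra]).
assert (H2 : 0 < / k ^ 2) by (apply Rinv_0_lt_compat; nra).
set (u := sinh (b * x)). set (v := cos (a * x)).
destruct (Rle_lt_dec x x0) as [H|H].
- assert (Hv : cos 1 <= v).
  { assert (Habs : Rabs (a * x) <= 1).
    { rewrite Rabs_mult, (Rabs_right x) by lra.
      apply Rle_trans with (Rabs a * x0); [nra|].
      unfold x0. apply Rmult_le_reg_r with (Rabs a + 1); [lra|].
      rewrite Rmult_assoc, Rinv_l by lra. lra. }
    unfold v. replace (cos (a * x)) with (cos (Rabs (a * x))).
    - pose proof PI2_1. apply cos_decr_1; try lra. apply Rabs_pos.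
    - unfold Rabs. destruct (Rcase_abs _); [apply cos_neg|auto]. }
  apply Rle_trans with (exp (b * x0) / cos 1 ^ 2 * cos 1 ^ 2).
  + replace (exp (b * x0) / cos 1 ^ 2 * cos 1 ^ 2) with (exp (b * x0)) by (field; lra).
    apply exp_le; nra.
  + assert (cos 1 ^ 2 <= v ^ 2) by (apply pow_incr; lra).
    pose proof (pow2_ge_0 u). nra.
- assert (Hu : k * exp (b * x) <= u).
  { unfold k, u, sinh.
    assert (exp (- (b * x)) <= exp (- (2 * b * x0)) * exp (b * x)); [|lra].
    rewrite <- exp_plus. apply exp_le. nra. }
  assert (He : 1 <= exp (b * x)) by (rewrite <- exp_0; apply exp_le; nra).
  apply Rle_trans with (/ k ^ 2 * (k ^ 2 * exp (b * x) ^ 2)).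
  + rewrite <- Rmult_assoc, Rinv_l by nra. nra.
  + assert (k ^ 2 * exp (b * x) ^ 2 <= u ^ 2).
    { rewrite <- Rpow_mult_distr. apply pow_incr. nra. }
    pose proof (pow2_ge_0 v). pose proof (pow2_ge_0 u). nra.
Qed.

(** The bracket in the numerator is at most sinh (b x) + cosh (b x) = e^{bx}, so [exp_le_denom]
    gives a B independent of n. *)
Lemma sech_remainder_bound (a b : R) : 0 < b ->
  exists B, 0 < B /\ forall n x, 0 < x ->
    Rabs (sech_remainder a b n x) <= B * exp (- (2 * INR n * b * x)).
Proof.
intros Hb. destruct (exp_le_denom a b Hb) as [B [HB HBd]].
exists B; split; auto. intros n x Hx.
pose proof (denom_pos a b x Hb Hx) as Hd. specialize (HBd x Hx).
unfold sech_remainder, Rdiv. rewrite !Rabs_mult, pow_1_abs, Rmult_1_l, (Rabs_inv (denom a b x)).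
rewrite (Rabs_right (exp _)) by (left; apply exp_pos).
rewrite (Rabs_right (denom a b x)) by lra.
rewrite (Rmult_comm B), Rmult_assoc. apply Rmult_le_compat_l; [left; apply exp_pos|].
apply Rmult_le_reg_r with (denom a b x); auto.
rewrite Rmult_assoc, Rinv_l, Rmult_1_r by lra.
eapply Rle_trans; [|exact HBd].
eapply Rle_trans; [apply Rabs_triang|]. rewrite !Rabs_mult.
assert (Hbd : forall y, Rabs (cos y) <= 1 /\ Rabs (sin y) <= 1).
{ intros y. split; apply Rabs_le; [apply COS_bound|apply SIN_bound]. }
assert (Hs : 0 < sinh (b * x)) by (apply sinh_pos; nra).
assert (Hsc : sinh (b * x) + cosh (b * x) = exp (b * x)) by (unfold sinh, cosh; field).
assert (Hch : 0 < cosh (b * x)).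
{ unfold cosh. pose proof (exp_pos (b * x)). pose proof (exp_pos (- (b * x))). lra. }
rewrite (Rabs_right (sinh _)), (Rabs_right (cosh _)) by lra.
rewrite <- Hsc.
assert (H : forall u v w, 0 <= u <= 1 -> 0 <= v <= 1 -> 0 < w -> u * w * v <= w).
{ intros u v w Hu Hv Hw. assert (u * w <= w) by nra. assert (0 <= u * w) by nra. nra. }
apply Rplus_le_compat; apply H; auto; split; try apply Rabs_pos; apply Hbd.
Qed.

Lemma ex_derive_sech_remainder (a b : R) (n : nat) (x : R) :
  0 < b -> 0 < x -> ex_derive (sech_remainder a b n) x.
Proof.
intros Hb Hx. pose proof (denom_pos a b x Hb Hx) as Hd.
unfold denom, cosh in Hd.
unfold sech_remainder, denom, sinh, cosh. auto_derive. lra.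
Qed.

Lemma is_RInt_0_infty_unique (f : R -> C) (l1 l2 : C) :
  is_RInt_0_infty f l1 -> is_RInt_0_infty f l2 -> l1 = l2.
Proof.
intros H1 H2.
transitivity (RInt_gen (V := C_R_CompleteNormedModule) f (at_right 0) (Rbar_locally p_infty)).
- symmetry. now apply (is_RInt_gen_unique (V := C_R_CompleteNormedModule)).
- now apply (is_RInt_gen_unique (V := C_R_CompleteNormedModule)).
Qed.

Lemma Rcpow_sub_1 (p : C) (x : R) : Rcpow x (p - 1) = mellin_kernel p 0 x.
Proof. unfold Rcpow, mellin_kernel. f_equal. ring. Qed.

(** The scaling k = ln n with c = 2b turns the decay e^{-2nbx} into n^{-Re p}. At n = 0 the
    pointwise bound is constant and gives no control at infinity, hence 0 < n. *)
Lemma sech_remainder_integral (a b : R) (p : C) : 0 < b -> 0 < Re p ->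
  exists A, 0 < A /\ forall n, (0 < n)%nat ->
    exists l, is_RInt_0_infty (fun x => RtoC (sech_remainder a b n x) * mellin_kernel p 0 x)%C l
      /\ Cmod l <= A * exp (- Re p * ln (INR n)).
Proof.
intros Hb Hp.
destruct (sech_remainder_bound a b Hb) as [B [HB HBb]].
destruct (power_exp_le_logistic_deriv (Re p) (2 * b) Hp ltac:(lra)) as [A [HA HAb]].
exists (B * A). split; [nra|]. intros n Hn.
assert (HN : 0 < INR n) by (now apply lt_0_INR).
apply (ex_RInt_0_infty_of_bound (Re p) (ln (INR n))); auto.
- apply Rmult_le_pos; [nra|left; apply exp_pos].
- intros e M He HM. apply ex_RInt_mult_mellin_kernel; auto.
  intros x Hx. now apply ex_derive_sech_remainder.
- intros x Hx. rewrite Cmod_mult, Cmod_R, Cmod_mellin_kernel.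
  specialize (HAb (ln (INR n)) x Hx). rewrite exp_ln in HAb by auto.
  replace (exp ((Re p - 1) * ln x - Re 0 * x)) with (exp ((Re p - 1) * ln x))
    by (f_equal; simpl; ring).
  eapply Rle_trans.
  { apply Rmult_le_compat_r; [left; apply exp_pos|]. now apply HBb. }
  rewrite Rmult_assoc, <- exp_plus.
  replace (- (2 * INR n * b * x) + (Re p - 1) * ln x)
    with ((Re p - 1) * ln x - 2 * b * INR n * x) by ring.
  rewrite (Rmult_assoc B A), (Rmult_assoc B).
  apply Rmult_le_compat_l; [lra|exact HAb].
Qed.

(** * Integration of a single term *)

(** An explicit logarithm of n (b + i a); [atan] gives its argument because b > 0. *)
Lemma polar_atan (a b n : R) : 0 < b -> 0 < n ->
  Cexp (ln n + ln (a ^ 2 + b ^ 2) / 2, atan (a / b)) = (n * b, n * a).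
Proof.
intros Hb Hn.
change ((exp (ln n + ln (a ^ 2 + b ^ 2) / 2) * cos (atan (a / b)),
         exp (ln n + ln (a ^ 2 + b ^ 2) / 2) * sin (atan (a / b))) = (n * b, n * a)).
assert (Hq : 0 < 1 + (a / b) ^ 2) by (pose proof (pow2_ge_0 (a / b)); lra).
assert (E : exp (ln n + ln (a ^ 2 + b ^ 2) / 2) = n * (b * sqrt (1 + (a / b) ^ 2))).
{ rewrite exp_plus, exp_ln by auto. f_equal.
  replace (a ^ 2 + b ^ 2) with (b ^ 2 * (1 + (a / b) ^ 2)) by (field; lra).
  rewrite ln_mult by nra. replace (b ^ 2) with (b * b) by ring.
  rewrite ln_mult by auto.
  replace ((ln b + ln b + ln (1 + (a / b) ^ 2)) / 2)
    with (ln b + / 2 * ln (1 + (a / b) ^ 2)) by field.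
  rewrite exp_plus, exp_ln by auto. f_equal.
  change (Rpower (1 + (a / b) ^ 2) (/ 2) = sqrt (1 + (a / b) ^ 2)).
  now apply Rpower_sqrt. }
assert (Hr : sqrt (1 + (a / b) ^ 2) <> 0) by (apply Rgt_not_eq, sqrt_lt_R0; auto).
rewrite E, cos_atan, sin_atan. rewrite Rsqr_pow2.
set (q := sqrt _) in *. clearbody q.
apply injective_projections; simpl; field; repeat split; auto; lra.
Qed.

(** Euler's formula for the sine, with the conjugate exponents u - iv and u + iv. *)
Lemma mellin_kernel_decomposition (p : C) (u v x : R) :
  (RtoC (exp (- (u * x)) * sin (v * x)) * mellin_kernel p 0 x)%C
  = (/ (2 * Ci) * (mellin_kernel p (u, (- v)%R) x - mellin_kernel p (u, v) x))%C.
Proof.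
unfold mellin_kernel.
replace ((p - 1) * RtoC (ln x) - 0 * RtoC x)%C with ((p - 1) * RtoC (ln x))%C by ring.
unfold Cminus at 3 5. rewrite !Cexp_plus.
set (E := Cexp _).
set (X := exp (- (u * x)) * cos (v * x)). set (Y := exp (- (u * x)) * sin (v * x)).
replace (Cexp (- ((u, (- v)%R) * RtoC x))%C) with (X, Y).
2:{ unfold Cexp, Re, Im, X, Y; simpl. f_equal; f_equal; f_equal; ring. }
replace (Cexp (- ((u, v) * RtoC x))%C) with (X, - Y).
2:{ unfold X, Y. rewrite <- (cos_neg (v * x)).
    replace (- (exp (- (u * x)) * sin (v * x))) with (exp (- (u * x)) * sin (- (v * x)))
      by (rewrite sin_neg; ring).
    unfold Cexp, Re, Im; simpl.
    f_equal; f_equal; f_equal; ring. }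
replace (X, Y) with (RtoC X + Ci * RtoC Y)%C by (apply injective_projections; simpl; ring).
replace (X, - Y) with (RtoC X - Ci * RtoC Y)%C by (apply injective_projections; simpl; ring).
field. intros H. apply (f_equal snd) in H. simpl in H. lra.
Qed.

(** The exponents n (b - i a) and n (b + i a) have logarithms L - i th and L + i th; the difference
    of e^{-p(L - i th)} and e^{-p(L + i th)}, divided by 2i, is n^{-p} (a^2 + b^2)^{-p/2} sin (p
    th). *)
Lemma term_integral (a b : R) (p : C) (k : nat) : 0 < b -> 0 < Re p ->
  is_RInt_0_infty
    (fun x => RtoC ((-1) ^ k * exp (- (INR (2 * k + 1) * b * x)) * sin (INR (2 * k + 1) * a * x))
              * mellin_kernel p 0 x)%C
    (CGamma p / Rcpow (a ^ 2 + b ^ 2) (p / 2) * Csin (p * RtoC (atan (a / b)))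
     * (RtoC ((-1) ^ k) / Rcpow (INR (2 * k + 1)) p))%C.
Proof.
intros Hb Hp. set (n := INR (2 * k + 1)).
assert (Hn : 0 < n) by (apply lt_0_INR; lia).
set (L := ln n + ln (a ^ 2 + b ^ 2) / 2). set (th := atan (a / b)).
assert (Hth : Rabs th < PI / 2).
{ pose proof (atan_bound (a / b)). fold th in H. apply Rabs_def1; lra. }
pose proof (is_RInt_mellin_kernel p (L, th) Hp Hth) as H1.
assert (Hth' : Rabs (Im (L, (- th)%R)) < PI / 2) by (simpl; now rewrite Rabs_Ropp).
pose proof (is_RInt_mellin_kernel p (L, (- th)%R) Hp Hth') as H2.
assert (E1 : Cexp (L, th) = (n * b, n * a)) by now apply polar_atan.
assert (E2 : Cexp (L, (- th)%R) = (n * b, - (n * a))).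
{ unfold Cexp, Re, Im in E1 |- *. simpl in E1 |- *.
  injection E1. intros Ha Hbb. rewrite cos_neg, sin_neg, Hbb, <- Ha. f_equal. ring. }
rewrite E1 in H1. rewrite E2 in H2.
pose proof (is_RInt_0_infty_Cmult (RtoC ((-1) ^ k) * / (2 * Ci)) _ _
  (is_RInt_0_infty_minus _ _ _ _ H2 H1)) as H3.
replace (CGamma p / Rcpow (a ^ 2 + b ^ 2) (p / 2) * Csin (p * RtoC th)
     * (RtoC ((-1) ^ k) / Rcpow n p))%C
 with (RtoC ((-1) ^ k) * / (2 * Ci) *
       (CGamma p * Cexp (- (p * (L, (- th)%R))) - CGamma p * Cexp (- (p * (L, th)))))%C.
- revert H3. apply is_RInt_0_infty_ext. intros x Hx.
  rewrite <- Cmult_assoc, <- mellin_kernel_decomposition, Cmult_assoc, <- RtoC_mult.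
  f_equal. f_equal. ring.
- unfold Csin, Rcpow, Cdiv. rewrite <- !Cexp_opp.
  replace (- (p * (L, (- th)%R)))%C with
    (- (p * RtoC (ln n)) + - (p / 2 * RtoC (ln (a ^ 2 + b ^ 2))) + Ci * (p * RtoC th))%C.
  2:{ replace (L, (- th)%R) with (RtoC (ln n) + / 2 * RtoC (ln (a ^ 2 + b ^ 2)) - Ci * RtoC th)%C.
      - unfold Cdiv. ring.
      - unfold L. rewrite <- RtoC_inv, <- RtoC_mult by lra.
        apply injective_projections; simpl; field. }
  replace (- (p * (L, th)))%C with
    (- (p * RtoC (ln n)) + - (p / 2 * RtoC (ln (a ^ 2 + b ^ 2))) + - (Ci * (p * RtoC th)))%C.
  2:{ replace (L, th) with (RtoC (ln n) + / 2 * RtoC (ln (a ^ 2 + b ^ 2)) + Ci * RtoC th)%C.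
      - unfold Cdiv. ring.
      - unfold L. rewrite <- RtoC_inv, <- RtoC_mult by lra.
        apply injective_projections; simpl; field. }
  rewrite !Cexp_plus. unfold Cdiv. ring.
Qed.

(** * Summation of the series *)

(** The integral exists with some value l. Removing terms one by one, the remainder of index n + 1
    has integral l - K times a partial sum; this tends to 0 by [sech_remainder_integral], which
    forces l = K S. Only limits of partial sums occur, so conditional convergence suffices. *)
Lemma mellin_sech_difference (a b : R) (p S : C) : 0 < b -> 0 < Re p ->
  is_series (V := C_R_NormedModule)
    (fun k : nat => (RtoC ((-1) ^ k) / Rcpow (INR (2 * k + 1)) p)%C) S ->
  is_RInt_0_infty (fun x => RtoC (sech_remainder a b 0 x) * mellin_kernel p 0 x)%C
    (CGamma p / Rcpow (a ^ 2 + b ^ 2) (p / 2) * Csin (p * RtoC (atan (a / b))) * S)%C.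
Proof.
intros Hb Hp HS.
set (K := (CGamma p / Rcpow (a ^ 2 + b ^ 2) (p / 2) * Csin (p * RtoC (atan (a / b))))%C).
set (u := fun k : nat => (RtoC ((-1) ^ k) / Rcpow (INR (2 * k + 1)) p)%C) in *.
destruct (sech_remainder_integral a b p Hb Hp) as [A [HA Hrem]].
assert (Hstep : forall n l,
  is_RInt_0_infty (fun x => RtoC (sech_remainder a b n x) * mellin_kernel p 0 x)%C l <->
  is_RInt_0_infty (fun x => RtoC (sech_remainder a b (Datatypes.S n) x) * mellin_kernel p 0 x)%C
    (l - K * u n)%C).
{ intros n l. pose proof (term_integral a b p n Hb Hp) as HT. fold K in HT. fold (u n) in HT.
  split; intros H.
  - refine (is_RInt_0_infty_ext _ _ _ _ (is_RInt_0_infty_minus _ _ _ _ H HT)).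
    intros x Hx. cbv beta. rewrite <- (sech_remainder_step a b n x Hb Hx), RtoC_minus. ring.
  - replace l with (l - K * u n + K * u n)%C by ring.
    refine (is_RInt_0_infty_ext _ _ _ _ (is_RInt_0_infty_plus _ _ _ _ H HT)).
    intros x Hx. cbv beta. rewrite <- (sech_remainder_step a b n x Hb Hx), RtoC_minus. ring. }
(* The decay bound starts at n = 1, so the integrand itself, of index 0, is reached by adding the
   first term back. *)
destruct (Hrem 1%nat ltac:(lia)) as [l1 [Hl1 _]].
set (l := (l1 + K * u O)%C).
assert (Hl : is_RInt_0_infty (fun x => RtoC (sech_remainder a b 0 x) * mellin_kernel p 0 x)%C l).
{ apply Hstep. unfold l. now replace (l1 + K * u O - K * u O)%C with l1 by ring. }
assert (Hn : forall n, is_RInt_0_infty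
   (fun x => RtoC (sech_remainder a b (Datatypes.S n) x) * mellin_kernel p 0 x)%C
   (l - K * sum_n (G := C_R_NormedModule) u n)%C).
{ induction n as [|n IH].
  - rewrite sum_O. exact (proj1 (Hstep O l) Hl).
  - rewrite sum_Sn. apply (proj1 (Hstep _ _)) in IH. revert IH.
    change (plus (sum_n (G := C_R_NormedModule) u n) (u (Datatypes.S n)))
      with (sum_n (G := C_R_NormedModule) u n + u (Datatypes.S n))%C.
    now replace (l - K * (sum_n (G := C_R_NormedModule) u n + u (Datatypes.S n)))%C
      with (l - K * sum_n (G := C_R_NormedModule) u n - K * u (Datatypes.S n))%C by ring. }
replace (K * S)%C with l; auto.
assert (Hz : Cmod (l - K * S) <= 0).
{ apply Rnot_lt_le. intros Hlt.
  set (eps := Cmod (l - K * S)) in *.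
  set (nf := norm_factor (V := C_R_NormedModule)).
  assert (Hnf : 0 < nf) by apply norm_factor_gt_0.
  pose proof (Cmod_ge_0 K) as HK.
  (* Half of eps is for the error of the partial sum times K, the other half for the remainder
     integral; [nf] converts a ball radius into a modulus. *)
  assert (He : 0 < eps / (2 * (Cmod K + 1) * nf)) by (apply Rdiv_lt_0_compat; nra).
  pose proof (proj1 (filterlim_locally _ _) HS (mkposreal _ He)) as HS'.
  pose proof (is_lim_seq_power_neg (Re p) (fun n => Datatypes.S n) Hp ltac:(intros; cbv beta; lia)) as HL.
  apply is_lim_seq_spec in HL.
  assert (He2 : 0 < eps / (2 * A)) by (apply Rdiv_lt_0_compat; lra).
  destruct (filter_ex (F := eventually) _ (filter_and _ _ HS' (HL (mkposreal _ He2))))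
    as [n [Ha Hb']].
  simpl pos in Hb'. rewrite Rminus_0_r, Rabs_right in Hb' by (left; apply exp_pos).
  apply norm_compat2 in Ha. rewrite norm_C_R in Ha. simpl pos in Ha. fold nf in Ha.
  change (Cmod (sum_n (G := C_R_NormedModule) u n - S)
     < nf * (eps / (2 * (Cmod K + 1) * nf))) in Ha.
  destruct (Hrem (Datatypes.S n) ltac:(lia)) as [l' [Hl' Hb'']].
  rewrite (is_RInt_0_infty_unique _ _ _ Hl' (Hn n)) in Hb''.
  set (s := (sum_n (G := C_R_NormedModule) u n : C)) in *.
  assert (eps <= Cmod (l - K * s) + Cmod K * Cmod (s - S)).
  { unfold eps. rewrite <- Cmod_mult.
    replace (l - K * S)%C with ((l - K * s) + K * (s - S))%C by ring. apply Cmod_triangle. }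
  assert (A * exp (- Re p * ln (INR (Datatypes.S n))) < eps / 2).
  { replace (eps / 2) with (A * (eps / (2 * A))) by (field; lra).
    now apply Rmult_lt_compat_l. }
  assert (Cmod K * Cmod (s - S) <= eps / 2).
  { replace (nf * (eps / (2 * (Cmod K + 1) * nf))) with (eps / 2 / (Cmod K + 1)) in Ha
      by (field; lra).
    apply Rle_trans with ((Cmod K + 1) * (eps / 2 / (Cmod K + 1))).
    - pose proof (Cmod_ge_0 (s - S)). nra.
    - right; field; lra. }
  lra. }
pose proof (Cmod_ge_0 (l - K * S)).
assert (l - K * S = 0)%C by (apply Cmod_eq_0; lra).
replace l with (l - K * S + K * S)%C by ring. rewrite H0. ring.
Qed.

(** For Re p <= 1 the series converges only conditionally; [is_series] takes its sum as the limit of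
    the partial sums. With b <> 0 the denominator 2 |cosh (w x)|^2 is positive on (0, oo). *)
Theorem mainTheorem14 :
  forall (a b : R) (p : C),
    b <> 0 ->
    0 < Re p ->
    exists S : C,
      is_series (V := C_R_NormedModule)
        (fun k : nat => (RtoC ((-1) ^ k) / Rcpow (INR (2 * k + 1)) p)%C) S
      /\
      is_RInt_0_infty
        (fun x : R =>
           (RtoC (sin (a * x) * sinh (b * x)
                  / (cos (2 * a * x) + cosh (2 * b * x)))
            * Rcpow x (p - 1))%C)
        (CGamma p / Rcpow (a ^ 2 + b ^ 2) (p / 2)
         * Csin (p * RtoC (atan (a / b))) * S)%C.
Proof.
intros a b p Hb Hp.
destruct (beta_series_converges p Hp) as [S HS].
exists S; split; auto.
(* [a] and [b] are bound anew so that the result can also be applied to (-a, -b). *)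
assert (Hpos : forall a b, 0 < b -> is_RInt_0_infty
        (fun x : R =>
           (RtoC (sin (a * x) * sinh (b * x)
                  / (cos (2 * a * x) + cosh (2 * b * x)))
            * Rcpow x (p - 1))%C)
        (CGamma p / Rcpow (a ^ 2 + b ^ 2) (p / 2)
         * Csin (p * RtoC (atan (a / b))) * S)%C).
{ clear a b Hb. intros a b Hb.
  refine (is_RInt_0_infty_ext _ _ _ _ (mellin_sech_difference a b p S Hb Hp HS)).
  intros x Hx. cbv beta. rewrite Rcpow_sub_1. f_equal. f_equal.
  unfold sech_remainder, denom. simpl INR. rewrite Rmult_0_r, !Rmult_0_l, cos_0, sin_0, Ropp_0, exp_0.
  simpl pow. unfold Rdiv. ring. }
destruct (Rlt_or_le 0 b) as [H|H]; [auto|].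
specialize (Hpos (- a) (- b) ltac:(lra)).
replace ((- a) ^ 2 + (- b) ^ 2) with (a ^ 2 + b ^ 2) in Hpos by ring.
replace (- a / - b) with (a / b) in Hpos by (field; lra).
revert Hpos. apply is_RInt_0_infty_ext. intros x Hx.
f_equal. f_equal.
replace (- a * x) with (- (a * x)) by ring.
replace (- b * x) with (- (b * x)) by ring.
replace (2 * - a * x) with (- (2 * a * x)) by ring.
replace (2 * - b * x) with (- (2 * b * x)) by ring.
rewrite sin_neg, cos_neg. unfold sinh, cosh. rewrite !Ropp_involutive.
rewrite (Rplus_comm (exp (- (2 * b * x)))). unfold Rdiv. ring.
Qed.
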